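(* Let $\Lambda = (\lambda_k)_{k=0}^\infty$ be a strictly increasing sequence of non-negative real numbers with $\sum_{k=1}^\infty 1/\lambda_k < \infty$, and let $M(\Lambda) = \overline{\operatorname{span}}\{t^{\lambda_k}\}_{k=0}^\infty \subset C[0,1]$ be the associated Müntz space. Then the dual space $M(\Lambda)^*$ is octahedral.
   Context: $C[0,1]$ is the Banach space of real-valued continuous functions on $[0,1]$ with the max-norm. For a strictly increasing sequence $\Lambda = (\lambda_k)_{k=0}^\infty$ of non-negative real numbers, $M(\Lambda)$ denotes the closed linear span in $C[0,1]$ of the functions $t \mapsto t^{\lambda_k}$, $k \ge 0$ (with $t^0 = 1$), with the inherited norm. $M(\Lambda)$ is called a Müntz space if $\sum_{k=1}^\infty 1/\lambda_k < \infty$. A Banach space $X$ is octahedral if for every finite-dimensional subspace $F$ of $X$ and every $\varepsilon > 0$ there exists $y$ in the unit sphere $S_X$ such that $\|x + y\| \ge (1-\varepsilon)(\|x\| + 1)$ for all $x \in F$. *)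

(* Defs.v *)
From HB Require Import structures.
From mathcomp Require Import all_boot all_order all_algebra.
From mathcomp Require Import all_classical all_reals all_analysis.

Set Implicit Arguments.
Unset Strict Implicit.
Unset Printing Implicit Defensive.

Import Order.TTheory GRing.Theory Num.Theory.
Import numFieldNormedType.Exports.

Local Open Scope classical_set_scope.
Local Open Scope ring_scope.

Section Span.
Context {R : realType} {V : normedModType R}.
Implicit Types A : set V.

Definition lspan A : set V :=
  [set v | exists (n : nat) (a : 'I_n -> R) (u : 'I_n -> V),
    (forall i, A (u i)) /\ v = \sum_(i < n) a i *: u i].

Lemma lspan0 A : lspan A 0.
Proof. by exists 0%N, (fun=> 0), (fun=> 0); split=> [[]//|]; rewrite big_ord0. Qed.

Lemma lspan_lin A (c : R) x y : lspan A x -> lspan A y -> lspan A (c *: x + y).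
Proof.
move=> [m [a [u [uA ->]]]] [n [b [v [vA ->]]]].
pose a' i := match fintype.split i with inl j => c * a j | inr j => b j end.
pose u' i := match fintype.split i with inl j => u j | inr j => v j end.
exists (m + n)%N, a', u'; split; first by move=> i; rewrite /u'; case: fintype.split.
rewrite big_split_ord scaler_sumr /=; congr (_ + _); apply: eq_bigr => i _.
  by rewrite /a' /u' (unsplitK (inl i)) scalerA.
by rewrite /a' /u' (unsplitK (inr i)).
Qed.

Lemma sub_lspan A : A `<=` lspan A.
Proof.
move=> x Ax; exists 1%N, (fun=> 1), (fun=> x); split=> //.
by rewrite big_ord1 scale1r.
Qed.

Definition closed_lspan A : {pred V} := mem (closure (lspan A)).

Lemma closed_lspan_submod A : submod_closed (closed_lspan A).
Proof.
split=> [|c x y]; first by apply/mem_set/subset_closure/lspan0.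
move=> /set_mem clx /set_mem cly; apply/mem_set => /= B Bxy.
have cf : (fun z : V * V => c *: z.1 + z.2) @ (x, y) --> c *: x + y.
  by apply: cvgD; [apply: cvgZl_tmp; exact: cvg_fst | exact: cvg_snd].
have [[P Q] /= [Px Qy] PQB] := cf _ Bxy.
have [x' [Ax' Px']] := clx _ Px; have [y' [Ay' Qy']] := cly _ Qy.
by exists (c *: x' + y'); split; [exact: lspan_lin | exact: (PQB (x', y'))].
Qed.

HB.instance Definition _ A := GRing.isSubmodClosed.Build R V (closed_lspan A)
  (closed_lspan_submod A).

End Span.

Section ClosedSpan.
Context {R : realType} {V : normedModType R} (A : set V).

Record closed_span := ClosedSpan {
  closed_span_val :> V ;
  _ : closed_span_val \in closed_lspan A }.

HB.instance Definition _ := [isSub for closed_span_val].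
HB.instance Definition _ := [Choice of closed_span by <:].
HB.instance Definition _ := [SubChoice_isSubLmodule of closed_span by <:].

Definition closed_span_norm (x : closed_span) : R := `|val x|.

Let normD x y :
  closed_span_norm (x + y) <= closed_span_norm x + closed_span_norm y.
Proof. by rewrite /closed_span_norm raddfD ler_normD. Qed.

Let normZ (l : R) x : closed_span_norm (l *: x) = `|l| * closed_span_norm x.
Proof. by rewrite /closed_span_norm linearZ /= normrZ. Qed.

Let norm0_eq0 x : closed_span_norm x = 0 -> x = 0.
Proof. by move/normr0_eq0 => x0; apply: val_inj; rewrite x0 raddf0. Qed.

HB.instance Definition _ :=
  @Lmodule_isNormed.Build R closed_span closed_span_norm normD normZ norm0_eq0.

Lemma closed_span_normE (x : closed_span) : `|x| = `|val x|.
Proof. by []. Qed.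

End ClosedSpan.

Section Dual.
Context {R : realType} (V : normedModType R).

Definition dual_pred : {pred V -> R^o} :=
  mem [set f : V -> R^o | linear f /\ continuous f].

Lemma dual_pred_submod : submod_closed dual_pred.
Proof.
split=> [|c f g].
  apply/mem_set; split=> [a x y|x]; last exact: cvg_cst.
  by rewrite /= scaler0 addr0.
move=> /set_mem[lf cf] /set_mem[lg cg]; apply/mem_set; split=> [a x y|x].
  rewrite !fctE lf lg !scalerDr !scalerA (mulrC c).
  by rewrite -!addrA; congr (_ + _); rewrite addrCA.
by apply: cvgD; [apply: cvgZl_tmp; exact: cf | exact: cg].
Qed.

HB.instance Definition _ := GRing.isSubmodClosed.Build R (V -> R^o) dual_pred
  dual_pred_submod.

Record dual := Dual { dual_fun :> V -> R^o ; _ : dual_fun \in dual_pred }.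

HB.instance Definition _ := [isSub for dual_fun].
HB.instance Definition _ := [Choice of dual by <:].
HB.instance Definition _ := [SubChoice_isSubLmodule of dual by <:].

Lemma dual_linear (f : dual) : linear f.
Proof. by case: f => f /= /set_mem[]. Qed.

HB.instance Definition _ (f : dual) :=
  GRing.isLinear.Build R V R^o _ (dual_fun f) (dual_linear f).

Lemma dual_continuous (f : dual) : continuous f.
Proof. by case: f => f /= /set_mem[]. Qed.

Definition dual_norm (f : dual) : R :=
  sup [set `|f x| | x in [set x : V | `|x| <= 1]].

Lemma has_sup_dual_norm (f : dual) :
  has_sup [set `|f x| | x in [set x : V | `|x| <= 1]].
Proof.
split; first by exists `|f 0|, 0 => //=; rewrite normr0.
have /linear_boundedP : bounded_near f (nbhs (0 : V)).
  exact/continuous_linear_bounded/dual_continuous.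
move=> /pinfty_ex_gt0[r r0 fr]; exists r => _ [x /= x1 <-].
by rewrite (le_trans (fr x))// ler_piMr// ltW.
Qed.

Lemma dual_norm_ge (f : dual) (x : V) : `|x| <= 1 -> `|f x| <= dual_norm f.
Proof.
by move=> x1; apply: ub_le_sup; [case: (has_sup_dual_norm f) | exists x].
Qed.

Lemma dual_norm_le (f : dual) (M : R) :
  (forall x : V, `|x| <= 1 -> `|f x| <= M) -> dual_norm f <= M.
Proof.
move=> fM; apply: ge_sup; first by case: (has_sup_dual_norm f).
by move=> _ [x x1 <-]; exact: fM.
Qed.

Let normD f g : dual_norm (f + g) <= dual_norm f + dual_norm g.
Proof.
apply: dual_norm_le => x x1.
by rewrite (le_trans (ler_normD _ _))// lerD// dual_norm_ge.
Qed.

Let normZ_le (l : R) f : dual_norm (l *: f) <= `|l| * dual_norm f.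
Proof.
apply: dual_norm_le => x x1.
by rewrite [leLHS]normrM ler_wpM2l// dual_norm_ge.
Qed.

Let normZ (l : R) f : dual_norm (l *: f) = `|l| * dual_norm f.
Proof.
apply/eqP; rewrite eq_le normZ_le /=.
have [->|l0] := eqVneq l 0.
  by rewrite normr0 mul0r (le_trans _ (dual_norm_ge _ (x := 0) _))// normr0.
rewrite -ler_pdivlMl ?normr_gt0// -normfV.
by rewrite (le_trans _ (normZ_le _ _))// scalerA mulVf// scale1r.
Qed.

Let norm0_eq0 f : dual_norm f = 0 -> f = 0.
Proof.
move=> f0; apply/val_inj/funext => x /=.
have [->|x0] := eqVneq x 0; first by rewrite linear0.
have : `|f (`|x|^-1 *: x)| <= 0.
  rewrite -f0 dual_norm_ge// normrZ normfV normr_id mulVf//.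
  by rewrite normr_eq0.
rewrite normr_le0 linearZ /= scaler_eq0 invr_eq0 normr_eq0 (negbTE x0) /=.
by move/eqP.
Qed.

HB.instance Definition _ :=
  @Lmodule_isNormed.Build R dual dual_norm normD normZ norm0_eq0.

Lemma dual_normE (f : dual) :
  `|f| = sup [set `|f x| | x in [set x : V | `|x| <= 1]].
Proof. by []. Qed.

End Dual.

Notation I01 R := (set_type (`[0%R, 1%R]%classic : set R)).

Section C01.
Context (R : realType).

Definition C01_pred : {pred I01 R -> R^o} :=
  mem [set f : I01 R -> R^o | continuous f].

Lemma C01_pred_submod : submod_closed C01_pred.
Proof.
split=> [|c f g]; first by apply/mem_set => x; exact: cst_continuous.
move=> /set_mem cf /set_mem cg; apply/mem_set => x.
apply: (@continuousD _ _ _ (c \*: f) g); last exact: cg.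
exact: (@continuousZl_tmp _ _ _ f c) (cf x).
Qed.

HB.instance Definition _ := GRing.isSubmodClosed.Build R (I01 R -> R^o) C01_pred
  C01_pred_submod.

Record C01 := MkC01 { C01_fun :> I01 R -> R^o ; _ : C01_fun \in C01_pred }.

HB.instance Definition _ := [isSub for C01_fun].
HB.instance Definition _ := [Choice of C01 by <:].
HB.instance Definition _ := [SubChoice_isSubLmodule of C01 by <:].

Lemma C01_continuous (f : C01) : continuous f.
Proof. by case: f => f /= /set_mem. Qed.

(* The supremum is attained, [0, 1] being compact: this is the max-norm. *)
Definition C01_norm (f : C01) : R := sup (range (fun t => `|f t|)).

Lemma has_sup_C01_norm (f : C01) : has_sup (range (fun t => `|f t|)).
Proof.
have I0 : (0 : R) \in (`[0, 1]%classic : set R).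
  by rewrite inE /= in_itv /= lexx ler01.
split; first by exists `|f (exist _ 0 I0)|, (exist _ 0 I0).
have /subspace_valL_continuousP/continuous_compact cf := @C01_continuous f.
have /compact_bounded[M [_ fM]] := cf (@segment_compact R 0 1).
exists (M + 1) => _ [t _ <-]; apply: (fM (M + 1)); first by rewrite ltrDl.
exists (set_val t); first exact/set_valP.
by rewrite -[LHS]/((valL f \o set_val) t) -/(sigL _ (valL f)) valLK.
Qed.

Lemma C01_norm_ge (f : C01) (t : I01 R) : `|f t| <= C01_norm f.
Proof. by apply: ub_le_sup; [case: (has_sup_C01_norm f) | exists t]. Qed.

Lemma C01_norm_le (f : C01) (M : R) :
  (forall t, `|f t| <= M) -> C01_norm f <= M.
Proof.
move=> fM; apply: ge_sup; first by case: (has_sup_C01_norm f).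
by move=> _ [t _ <-].
Qed.

Let normD f g : C01_norm (f + g) <= C01_norm f + C01_norm g.
Proof.
apply: C01_norm_le => t.
by rewrite (le_trans (ler_normD _ _))// lerD// C01_norm_ge.
Qed.

Let normZ_le (l : R) f : C01_norm (l *: f) <= `|l| * C01_norm f.
Proof.
by apply: C01_norm_le => t; rewrite [leLHS]normrM ler_wpM2l// C01_norm_ge.
Qed.

Let normZ (l : R) f : C01_norm (l *: f) = `|l| * C01_norm f.
Proof.
apply/eqP; rewrite eq_le normZ_le /=.
have [->|l0] := eqVneq l 0.
  rewrite normr0 mul0r; have [[_ [t _ _]] _] := has_sup_C01_norm f.
  exact: le_trans (C01_norm_ge _ t).
rewrite -ler_pdivlMl ?normr_gt0// -normfV.
by rewrite (le_trans _ (normZ_le _ _))// scalerA mulVf// scale1r.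
Qed.

Let norm0_eq0 f : C01_norm f = 0 -> f = 0.
Proof.
move=> f0; apply/val_inj/funext => t /=.
by apply/eqP; rewrite -normr_le0 -f0 C01_norm_ge.
Qed.

HB.instance Definition _ :=
  @Lmodule_isNormed.Build R C01 C01_norm normD normZ norm0_eq0.

Lemma C01_normE (f : C01) : `|f| = sup (range (fun t => `|f t|)).
Proof. by []. Qed.

End C01.

Section Muntz.
Context {R : realType}.

(* [powR] satisfies 0 `^ 0 = 1, so the exponent 0 gives the constant 1. *)
Lemma powR_C01 (l : R) : 0 <= l ->
  (fun t : I01 R => set_val t `^ l : R^o) \in @C01_pred R.
Proof.
move=> l0; apply/mem_set => /=.
have [->|ln0] := eqVneq l 0.
  rewrite (_ : (fun _ => _) = cst (1 : R^o)); last first.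
    by apply/funext => t; rewrite powRr0.
  by move=> t; exact: cst_continuous.
have lp : 0 < l by rewrite lt_neqAle eq_sym ln0.
move=> t; have cv : {for t, continuous (set_val : I01 R -> R)}.
  exact: initial_continuous.
have t01 (u : I01 R) : 0 <= set_val u.
  by have := set_valP u; rewrite /= in_itv /= => /andP[].
have := t01 t; rewrite le_eqVlt => /predU1P[t0|tp].
  have Ft : Filter (nbhs t) by exact: nbhs_filter.
  apply/(@cvgrPdist_lt _ _ _ (nbhs t)) => e e0.
  have d0 : 0 < e `^ l^-1 by rewrite powR_gt0.
  have /(@cvgrPdist_lt _ _ _ (nbhs t))/(_ _ d0) := cv; apply: filterS => u.
  rewrite -t0 powR0// !sub0r !normrN (ger0_norm (t01 u)).
  rewrite ger0_norm ?powR_ge0// => ud.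
  have -> : e = (e `^ l^-1) `^ l by rewrite -powRrM mulVf// powRr1// ltW.
  by apply: gt0_ltr_powR; rewrite ?nnegrE// ltW.
apply: (@continuous_comp _ _ _ (set_val : I01 R -> R) (fun x : R => x `^ l)).
  exact: cv.
apply/differentiable_continuous/derivable1_diffP/derivable_powR.
by rewrite in_itv /= tp.
Qed.

Definition monomial (l : R) (l0 : 0 <= l) : C01 R := MkC01 (powR_C01 l0).

Definition muntz (L : nat -> R) (L0 : forall k, 0 <= L k) :
    normedModType R :=
  closed_span [set monomial (L0 k) | k in [set: nat]].

End Muntz.

(* Over a field, the finite-dimensional subspaces are exactly the spans of
   finite lists of vectors. *)
Definition finite_dim_subspace {R : realType} {X : normedModType R}
    (F : set X) : Prop :=
  exists s : seq X, F = lspan [set` s].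

Definition octahedral {R : realType} (X : normedModType R) : Prop :=
  forall F : set X, finite_dim_subspace F ->
  forall e : R, 0 < e ->
  exists y : X, `|y| = 1 /\
    forall x, F x -> (1 - e) * (`|x| + 1) <= `|x + y|.

(* Main.v *)
(** In a Muntz space the differences [t^(L k) - t^(L k.+1)] are nonnegative and
telescope, so every functional [f] satisfies
[\sum_k |f (t^(L k)) - f (t^(L k.+1))| <= |f|] and hence almost annihilates
[p = t^(L n) - t^(L m)] for large [n <= m].  As [L] is unbounded, [p] can be chosen
close to 1 at a point [t] near 1 and small away from 1.  If [x] in the unit
ball almost norms [f], then [z = x + (1 - x t) p] has norm almost at most 1,
[z t] is almost 1 and [f z] is almost [f x].  Thus the normalized evaluation at
[t] is the octahedral direction, simultaneously for finitely many [f]; a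
finite net in the unit ball of a finite-dimensional subspace concludes. *)

From HB Require Import structures.
Require Import Defs.
From mathcomp Require Import all_boot all_order all_algebra.
From mathcomp Require Import all_classical all_reals all_analysis.
From mathcomp Require Import lra.
Import Order.TTheory GRing.Theory Num.Theory.
Import numFieldNormedType.Exports.
Local Open Scope classical_set_scope.
Local Open Scope ring_scope.

(** * Spans of finite lists: bounded coefficients and finite nets *)

(** Coefficients are indexed by all naturals, so that passing to the tail of [s] is a shift by
    [S]. *)
Definition seq_comb {R : realType} {X : normedModType R} (s : seq X)
  (a : nat -> R) : X := \sum_(i < size s) a i *: s`_i.

Lemma lspan_seqP (R : realType) (X : normedModType R) (s : seq X) (v : X) :
  lspan [set` s] v <-> exists a, v = seq_comb s a.
Proof.
split=> [[n [a [u [us ->]]]]|[a ->]].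
  (* Coefficients of repeated vectors are collected at the first position of the vector in [s]. *)
  pose b k := \sum_(i < n | index (u i) s == k) a i.
  exists b; rewrite /seq_comb.
  under [RHS]eq_bigr do rewrite scaler_suml.
  rewrite (exchange_big_dep xpredT)//=; apply: eq_bigr => i _.
  have si : (index (u i) s < size s)%N by rewrite index_mem; exact: us.
  rewrite (big_pred1 (Ordinal si)) => [|k]; last by rewrite eq_sym.
  by rewrite /= nth_index//; exact: us.
exists (size s), (fun i => a i), (fun i => s`_i); split=> // i.
exact: mem_nth.
Qed.

Lemma seq_comb_compact (R : realType) (X : normedModType R) (s : seq X) (M : R) :
  0 <= M ->
  compact [set seq_comb s a | a in [set a : nat -> R | forall i, `|a i| <= M]].
Proof.
move=> M0; have Kc : compact [set v : 'rV[R]_(size s) | forall i, `[- M, M]%classic (v ord0 i)].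
  by apply: (@rV_compact _ _ (fun=> `[- M, M]%classic)) => _; exact: segment_compact.
pose g (v : 'rV[R]_(size s)) : X := \sum_(i < size s) v ord0 i *: s`_i.
have gc : continuous g.
  move=> v; have Fv := nbhs_filter v; apply: cvg_big => [|i _]; first exact: add_continuous.
  by apply: cvgZr_tmp; exact: (@coord_continuous _ _ _ ord0 i v).
suff -> : [set seq_comb s a | a in [set a : nat -> R | forall i, `|a i| <= M]] =
    g @` [set v : 'rV[R]_(size s) | forall i, `[- M, M]%classic (v ord0 i)].
  by apply: continuous_compact => //; exact: continuous_subspaceT.
apply/seteqP; split=> _ [a /= aM <-].
  exists (\row_i a i) => [i|]; last by apply: eq_bigr => i _; rewrite mxE.
  by rewrite mxE in_itv/= -ler_norml.
exists (fun i => oapp (a ord0) 0 (insub i)) => [i|].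
  case: insubP => [j _ _|_] /=; first by have := aM j; rewrite in_itv/= -ler_norml.
  by rewrite normr0.
by apply: eq_bigr => i _; rewrite valK.
Qed.

(** Induction on [s], with no independence assumed. A head [u] in the span of the tail gets
    coefficient 0. Otherwise [u] is at distance at least some [d > 0] from that span, which bounds
    its coefficient by [r / d]. *)
Lemma bounded_seq_comb (R : realType) (X : normedModType R) (s : seq X) (r : R) :
  exists2 M : R, 0 <= M & forall v, lspan [set` s] v -> `|v| <= r ->
    exists2 a, (forall i, `|a i| <= M) & v = seq_comb s a.
Proof.
elim: s r => [|u s IH] r.
  exists 0 => // v /lspan_seqP[a ->] _; exists (fun=> 0).
    by move=> i; rewrite normr0.
  by rewrite /seq_comb !big_ord0.
have combS a : seq_comb (u :: s) a = a 0%N *: u + seq_comb s (a \o S).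
  by rewrite /seq_comb big_ord_recl.
have [us|us] := pselect (lspan [set` s] u).
  have [M M0 HM] := IH r; exists M => // v vs vr.
  have {}vs : lspan [set` s] v.
    move/lspan_seqP: vs => [a ->]; rewrite combS; apply: lspan_lin => //.
    by apply/lspan_seqP; exists (a \o S).
  have [a aM ->] := HM _ vs vr; exists (fun i => if i is j.+1 then a j else 0).
    by case=> [|j]; rewrite ?normr0.
  by rewrite combS scale0r add0r.
(* Vectors of the span within distance 1 of [u] have norm at most [|u| + 1], so they lie in one
   compact, hence closed, set of combinations that misses [u]. *)
have [M M0 HM] := IH (`|u| + 1).
have nK : ~ closure [set seq_comb s a | a in [set a : nat -> R | forall i, `|a i| <= M]] u.
  move=> /(compact_closed (@norm_hausdorff _ _) (seq_comb_compact _ _ s _ M0)).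
  by case=> a _ au; apply: us; apply/lspan_seqP; exists a.
have clu : ~ closure (lspan [set` s]) u.
  apply: contra_not nK => clu B /nbhs_ballP[e/= e0 eB].
  have e'0 : 0 < Num.min e 1 by rewrite lt_min e0/=.
  have [w [ws wB]] := clu _ (nbhsx_ballx u _ e'0).
  move: wB; rewrite -ball_normE/= lt_min => /andP[we w1].
  exists w; split; last by apply: eB; rewrite -ball_normE.
  have [|a aM ->] := HM w ws; last by exists a.
  rewrite -[w](subrK u) (le_trans (ler_normD _ _))// addrC lerD2l.
  by rewrite distrC ltW.
have [d d0 Hd] : exists2 d, 0 < d & forall w, lspan [set` s] w -> d <= `|u - w|.
  apply: contrapT => H; apply: clu => B /nbhs_ballP[d/= d0 dB].
  apply: contrapT => nB; apply: H; exists d => // w ws; rewrite leNgt.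
  by apply/negP => wd; apply: nB; exists w; split=> //; apply: dB; rewrite -ball_normE.
(* This radius bounds the tail part [v - a 0 *: u] of a vector [v] of norm at most [r]. *)
have [M' M'0 HM'] := IH (r + r / d * `|u|).
exists (Num.max (r / d) M'); first by rewrite le_max M'0 orbT.
move=> v /lspan_seqP[a ->]; rewrite combS => vr.
set w := seq_comb s (a \o S) in vr *.
have ws : lspan [set` s] w by apply/lspan_seqP; exists (a \o S).
have a0 : `|a 0%N| <= r / d.
  rewrite ler_pdivlMr//; have [->|an0] := eqVneq (a 0%N) 0.
    by rewrite normr0 mul0r (le_trans _ vr).
  rewrite (le_trans _ vr)//.
  have -> : a 0%N *: u + w = a 0%N *: (u - - (a 0%N)^-1 *: w).
    by rewrite scalerBr scalerA mulrN divff// scaleN1r opprK.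
  rewrite normrZ ler_wpM2l// Hd// -[_ *: w]addr0; apply: lspan_lin => //.
  exact: lspan0.
have [|b bM wb] := HM' w ws.
  rewrite -[w](addrK (a 0%N *: u)) (le_trans (ler_normB _ _))//.
  by rewrite lerD// 1?addrC// normrZ ler_wpM2r.
exists (fun i => if i is j.+1 then b j else a 0%N).
  by case=> [|j]; rewrite le_max ?a0// bM orbT.
by rewrite combS wb.
Qed.

Lemma lspan_finite_net (R : realType) (X : normedModType R) (s : seq X) (r e : R) :
  0 < e -> exists l : seq X, forall v, lspan [set` s] v -> `|v| <= r ->
    exists2 w, w \in l & `|v - w| < e.
Proof.
move=> e0; have [M M0 HM] := bounded_seq_comb _ _ s r.
have := seq_comb_compact _ _ s _ M0; rewrite compact_cover.
move=> /(_ X setT (fun w => ball w e)) [].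
- by move=> w _; exact: ball_open.
- by move=> v _; exists v => //; exact: ballxx.
move=> D _ DK; exists (finmap.enum_fset D) => v vs vr.
have [a aM va] := HM _ vs vr.
have [|w wD] := DK v; first by exists a.
by rewrite -ball_normE/= distrC => wv; exists w.
Qed.

(** * Reduction of octahedrality to finite lists of vectors *)

(** A finite net handles the unit ball of the subspace. A longer [x] reduces to its normalization
    [x'], since [|x| *: (x' + y)] differs from [x + y] by [(|x| - 1) *: y]. *)
Lemma octahedral_seq (R : realType) (X : normedModType R) :
  (forall (l : seq X) (e : R), 0 < e -> exists2 y, `|y| = 1 &
     forall x, x \in l -> (1 - e) * (`|x| + 1) <= `|x + y|) ->
  octahedral X.
Proof.
move=> H _ [s ->] e e0.
(* Exchanging [x] with its net point costs [d] twice, and the factor [1 - d] costs at most [2 * d]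
   more. *)
pose d := Num.min 1 e / 4.
have [d0 d1 de] : [/\ 0 < d, d <= 1 / 4 & 4 * d <= e].
  rewrite /d; have : 0 < Num.min 1 e by rewrite lt_min ltr01.
  have : Num.min 1 e <= 1 by rewrite ge_min lexx.
  have : Num.min 1 e <= e by rewrite ge_min lexx orbT.
  by move=> ? ? ?; split; lra.
have [l Hl] := lspan_finite_net _ _ s 1 _ d0.
have [y y1 Hy] := H l d d0.
have unit_ball x : lspan [set` s] x -> `|x| <= 1 -> `|x| + 1 - e <= `|x + y|.
  move=> xs x1; have [w wl xw] := Hl x xs x1.
  have := Hy w wl.
  have : `|x| <= `|w| + d.
    by rewrite -[x in leLHS](subrK w) addrC (le_trans (ler_normD _ _))// lerD2l ltW.
  have : `|w + y| <= `|x + y| + d.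
    rewrite -[w](subrK x) -addrA addrC (le_trans (ler_normD _ _))// lerD2l.
    by rewrite distrC ltW.
  by have := normr_ge0 w; nra.
exists y; split=> // x xs; have [x1|x1] := leP `|x| 1.
  by apply: (le_trans _ (unit_ball x xs x1)); have := normr_ge0 x; nra.
have a0 : 0 < `|x| by rewrite (lt_trans _ x1).
have : `|x| * `| `|x|^-1 *: x + y| <= `|x + y| + (`|x| - 1).
  rewrite -{1}[`|x|]normr_id -normrZ scalerDr scalerA divff ?gt_eqF// scale1r.
  have -> : `|x| - 1 = `|(`|x| - 1) *: y|.
    by rewrite normrZ y1 mulr1 ger0_norm// subr_ge0 ltW.
  rewrite (le_trans _ (ler_normD _ _))// scalerBl scale1r.
  by rewrite -addrA [y + _]addrC subrK.
have nx0 : `| `|x|^-1 *: x| = 1 by rewrite normrZ normfV normr_id mulVf// gt_eqF.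
have xs' : lspan [set` s] (`|x|^-1 *: x).
  by rewrite -[_ *: x]addr0; apply: lspan_lin => //; exact: lspan0.
have := unit_ball _ xs'; rewrite nx0 => /(_ (lexx _)).
nra.
Qed.

(** * Real powers on the unit interval and growth of the exponents *)

Lemma ger_powR_unit (R : realType) (s k l : R) :
  0 <= s <= 1 -> 0 <= k <= l -> s `^ l <= s `^ k.
Proof.
move=> /andP[s0 s1] /andP[k0 kl]; move: s0; rewrite le_eqVlt => /predU1P[<-|s0].
  have [->|k'] := eqVneq k 0; last first.
    by rewrite !powR0// gt_eqF// (lt_le_trans _ kl)// lt_neqAle eq_sym k'.
  rewrite powRr0; have [->|l'] := eqVneq l 0; first by rewrite powRr0.
  by rewrite powR0.
by apply: ger_powR; rewrite ?s0.
Qed.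

Lemma powR_le1_unit (R : realType) (s k : R) : 0 <= s <= 1 -> 0 <= k -> s `^ k <= 1.
Proof.
by move=> s01 k0; rewrite -(powRr0 s) ger_powR_unit// lexx.
Qed.

Lemma powR_small (R : realType) (s e : R) : 0 <= s < 1 -> 0 < e ->
  exists B, forall l, B < l -> s `^ l <= e.
Proof.
move=> /andP[]; rewrite le_eqVlt => /predU1P[<- _|s0 s1] e0.
  (* The strict bound [0 < l] excludes the value 1 of the power with base and exponent 0. *)
  by exists 0 => l l0; rewrite powR0 ?ltW// gt_eqF.
exists (ln e / ln s) => l.
have ls : ln s < 0 by rewrite ln_lt0// s0.
rewrite ltr_ndivrMr// => H; rewrite /powR gt_eqF//.
by rewrite -[leRHS]lnK ?posrE// ler_expR ltW.
Qed.

(** If every [L k] were at most [B], the first [n] terms would sum to at least [n / B], against the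
    finiteness of the series. *)
Lemma nneseries_inv_unbounded (R : realType) (L : nat -> R) (B : R) :
  {homo L : m n / (m < n)%N >-> m < n} -> 0 <= L 0%N ->
  (\sum_(1 <= k <oo) ((L k)^-1)%:E < +oo)%E ->
  exists N, forall n, (N <= n)%N -> B < L n.
Proof.
move=> Li L0 Ls.
have Lp k : (0 < k)%N -> 0 < L k by move=> k0; rewrite (le_lt_trans L0)// Li.
have Lle m n : (m <= n)%N -> L m <= L n.
  by rewrite leq_eqVlt => /predU1P[->//|/Li/ltW].
suff [N BN] : exists N, B < L N.
  by exists N => n /Lle; exact: lt_le_trans.
apply: contrapT => /forallNP H.
have LB k : L k <= B by rewrite leNgt; apply/negP/H.
have B0 : 0 < B by rewrite (lt_le_trans (Lp 1%N isT)).
set S := (X in (X < _)%E) in Ls.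
have Sn n : ((n%:R / B)%:E <= S)%E.
  apply: (@le_trans _ _ (\sum_(1 <= k < n.+1) ((L k)^-1)%:E)%E); last first.
    by apply: nneseries_lim_ge => k k1 _; rewrite lee_fin invr_ge0 ltW// Lp.
  rewrite sumEFin lee_fin (_ : n%:R / B = \sum_(1 <= k < n.+1) B^-1); last first.
    by rewrite sumr_const_nat subn1/= mulr_natl.
  by rewrite !big_nat; apply: ler_sum => k /andP[k1 _]; rewrite lef_pV2 ?posrE// Lp.
have S0 : (0 <= S)%E by have := Sn 0%N; rewrite mul0r.
have Sf : S \is a fin_num by rewrite ge0_fin_numE.
have := Sn (Num.truncn (B * fine S)).+1; rewrite -(fineK Sf) lee_fin.
rewrite ler_pdivrMr// leNgt => /negP; apply.
by rewrite mulrC truncnS_gt.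
Qed.

(** * Estimates for the dual norm *)

Lemma dual_apply_le (R : realType) (V : normedModType R) (f : dual V) (x : V) :
  `|f x| <= `|f| * `|x|.
Proof.
have [->|x0] := eqVneq x 0; first by rewrite linear0 !normr0 mulr0.
have nx : 0 < `|x| by rewrite normr_gt0.
rewrite -ler_pdivrMr// mulrC -[`|x|^-1]ger0_norm ?invr_ge0//.
rewrite -[leLHS]normrM -[_ * _]/(`|x|^-1 *: f x) -linearZ.
by apply: dual_norm_ge; rewrite normrZ normfV normr_id mulVf// gt_eqF.
Qed.

Lemma dual_norm_approx (R : realType) (V : normedModType R) (f : dual V) (e : R) :
  0 < e -> exists2 x : V, `|x| <= 1 & `|f| - e <= f x.
Proof.
move=> e0; have [_ [x /= x1 <-] fx] := sup_adherent e0 (has_sup_dual_norm f).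
have [f0|f0] := leP 0 (f x).
  by exists x => //; rewrite -(ger0_norm f0) ltW.
by exists (- x); rewrite ?normrN// linearN -(ltr0_norm f0) ltW.
Qed.

(** * Point evaluations and monomials in the Müntz space *)

Section Muntz.
Context {R : realType} {L : nat -> R} (L0 : forall k, 0 <= L k).
Implicit Types (z : muntz L0) (s : I01 R).

Definition muntz_eval s z : R^o := (val z : C01 R) s.

Lemma muntz_eval_linear s : linear (muntz_eval s).
Proof. by move=> c x z; rewrite /muntz_eval linearP. Qed.

HB.instance Definition _ s :=
  GRing.isLinear.Build R (muntz L0) R^o _ (muntz_eval s) (muntz_eval_linear s).

Lemma muntz_eval_le s z : `|muntz_eval s z| <= `|z|.
Proof. exact: C01_norm_ge. Qed.

Lemma muntz_norm_le z (M : R) : (forall s, `|muntz_eval s z| <= M) -> `|z| <= M.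
Proof. exact: C01_norm_le. Qed.

Lemma muntz_eval_continuous s : continuous (muntz_eval s).
Proof.
apply: bounded_linear_continuous; apply/linear_boundedP.
near=> r => z; rewrite (le_trans (muntz_eval_le s z))//.
by rewrite ler_peMl//; near: r; apply: nbhs_pinfty_ge; exact: num_real.
Unshelve. all: by end_near. Qed.

Lemma muntz_eval_dual s : muntz_eval s \in @dual_pred R (muntz L0).
Proof.
by apply/mem_set; split; [exact: muntz_eval_linear|exact: muntz_eval_continuous].
Qed.

Definition muntz_delta s : dual (muntz L0) := Dual (muntz_eval_dual s).

(** Equality can fail: evaluation at 0 vanishes when all exponents are positive. Hence the
    normalization of the direction built later. *)
Lemma muntz_delta_norm s : `|muntz_delta s| <= 1.
Proof.
by apply: dual_norm_le => z z1; rewrite (le_trans (muntz_eval_le s z)).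
Qed.

Lemma muntz_monomial_in k :
  monomial (L0 k) \in closed_lspan [set monomial (L0 k) | k in [set: nat]].
Proof. by apply/mem_set/subset_closure/sub_lspan; exists k. Qed.

Definition muntz_monomial k : muntz L0 := ClosedSpan (muntz_monomial_in k).

Lemma muntz_monomialE s k : muntz_eval s (muntz_monomial k) = set_val s `^ L k.
Proof. by []. Qed.

Lemma muntz_monomialB s m n :
  muntz_eval s (muntz_monomial m - muntz_monomial n) =
  set_val s `^ L m - set_val s `^ L n.
Proof. by rewrite linearB. Qed.

Lemma I01P s : 0 <= set_val s <= 1.
Proof. by have := set_valP s; rewrite /= in_itv. Qed.

End Muntz.

Arguments muntz_eval {R L L0} s z.

(** * Bounded variation of functionals along the monomials *)

Section MuntzVariation.
Context {R : realType} {L : nat -> R} (L0 : forall k, 0 <= L k).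
Context (Li : {homo L : m n / (m < n)%N >-> m < n}).
Local Notation e_ := (muntz_monomial L0).

Lemma muntz_monomial_antitone (s : I01 R) m n : (m <= n)%N ->
  set_val s `^ L n <= set_val s `^ L m.
Proof.
rewrite leq_eqVlt => /predU1P[->//|mn].
by rewrite ger_powR_unit ?I01P// L0 ltW// Li.
Qed.

Lemma muntz_variation (f : dual (muntz L0)) n :
  \sum_(0 <= k < n) `|f (e_ k) - f (e_ k.+1)| <= `|f|.
Proof.
(* The signs make [f z] the sum of absolute values. At each point the terms of [z] are dominated by
   nonnegative differences that telescope to at most 1, so [z] lies in the unit ball. *)
pose z : muntz L0 := \sum_(0 <= k < n) Num.sg (f (e_ k - e_ k.+1)) *: (e_ k - e_ k.+1).
have -> : \sum_(0 <= k < n) `|f (e_ k) - f (e_ k.+1)| = f z.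
  rewrite linear_sum; apply: eq_bigr => k _.
  by rewrite linearZ/= -[RHS]/(_ * _) linearB mulrC normrEsg mulrC.
rewrite (le_trans (ler_norm _))// dual_norm_ge//.
apply: muntz_norm_le => s; rewrite linear_sum.
rewrite (le_trans (ler_norm_sum _ _ _))//.
apply: (@le_trans _ _ (\sum_(0 <= k < n) - (set_val s `^ L k.+1 - set_val s `^ L k))).
  apply: ler_sum => k _; rewrite linearZ/= muntz_monomialB.
  rewrite opprB normrZ [X in _ * X]ger0_norm; last by rewrite subr_ge0 muntz_monomial_antitone.
  rewrite ler_piMl// ?subr_ge0 ?muntz_monomial_antitone//.
  by rewrite normr_sg; case: eqP.
rewrite sumrN telescope_sumr// opprB lerBlDr.
by rewrite (le_trans (powR_le1_unit _ _ _ (I01P s) (L0 _)))// lerDl powR_ge0.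
Qed.

(** The partial variations increase and are bounded; once one is within [e] of their supremum, all
    later increments together are at most [e]. *)
Lemma muntz_monomial_cauchy (f : dual (muntz L0)) (e : R) : 0 < e ->
  exists N, forall m n, (N <= m <= n)%N -> `|f (e_ m - e_ n)| <= e.
Proof.
move=> e0; pose S n : R := \sum_(0 <= k < n) `|f (e_ k) - f (e_ k.+1)|.
have Ssup : has_sup (range S).
  split; first by exists (S 0%N), 0%N.
  by exists `|f| => _ [n _ <-]; exact: muntz_variation.
have [_ [N _ <-] SN] := sup_adherent e0 Ssup.
exists N => m n /andP[Nm mn].
have Smono i j : (i <= j)%N -> S j = S i + \sum_(i <= k < j) `|f (e_ k) - f (e_ k.+1)|.
  by move=> ij; rewrite /S (big_cat_nat _ _ (n := i)).
have Sn : S n <= sup (range S) by apply: ub_le_sup; [case: Ssup|exists n].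
have SNm : S N <= S m by rewrite (Smono _ _ Nm) lerDl sumr_ge0.
have -> : f (e_ m - e_ n) = - \sum_(m <= k < n) (f (e_ k.+1) - f (e_ k)).
  by rewrite telescope_sumr// opprB linearB.
rewrite normrN (le_trans (ler_norm_sum _ _ _))//.
under eq_bigr do rewrite distrC.
have := Smono _ _ mn; lra.
Qed.

Lemma muntz_monomial_cauchy_seq (l : seq (dual (muntz L0))) (e : R) : 0 < e ->
  exists N, forall f, f \in l ->
    forall m n, (N <= m <= n)%N -> `|f (e_ m - e_ n)| <= e.
Proof.
move=> e0; elim: l => [|f l [N HN]]; first by exists 0%N.
have [M HM] := muntz_monomial_cauchy f e e0.
exists (maxn M N) => g; rewrite inE => gl m n; rewrite geq_max => /andP[/andP[Mm Nm] mn].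
by move: gl => /orP[/eqP->|gl]; [apply: HM; rewrite Mm|apply: HN; rewrite ?Nm].
Qed.

End MuntzVariation.

(** * Oscillation near 1, spikes and the octahedral direction *)

Lemma muntz_eval_near1 {R : realType} {L : nat -> R} {L0 : forall k, 0 <= L k}
    (x : muntz L0) (e : R) : 0 < e ->
  exists2 r, 0 <= r < 1 & forall s u : I01 R, r <= set_val s -> r <= set_val u ->
    `|muntz_eval s x - muntz_eval u x| <= e.
Proof.
move=> e0; have one01 : (1 : R) \in (`[0, 1]%classic : set R).
  by rewrite inE /= in_itv /= lexx ler01.
pose one : I01 R := exist _ 1 one01.
have e2 : 0 < e / 2 by rewrite divr_gt0.
have Fone : Filter (nbhs one) by exact: nbhs_filter.
have /(@cvgrPdist_lt _ _ _ (nbhs one))/(_ _ e2) := @C01_continuous R (val x) one.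
(* Open sets of the interval are traces of open sets [U] of the line. *)
rewrite nbhsE => -[_ [[U oU <-] U1] UB].
have /nbhs_ballP[d /= d0 dU] : nbhs (1 : R) U by apply: open_nbhs_nbhs.
have near1 (s : I01 R) : 1 - d < set_val s ->
    `|muntz_eval one x - muntz_eval s x| < e / 2.
  move=> sd; apply: UB; apply: dU; rewrite -ball_normE/=.
  by have /andP[_ s1] := I01P s; rewrite ger0_norm ?subr_ge0// ltrBlDr -ltrBlDl.
(* Halving [d] turns the non-strict [r <= s] into the strict [1 - d < s]. *)
exists (Num.max 0 (1 - d / 2)).
  by rewrite le_max lexx/= gt_max ltr01/=; lra.
move=> s u; rewrite !ge_max => /andP[_ sd] /andP[_ ud].
have := near1 s; have := near1 u.
have {}sd : 1 - d < set_val s by lra.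
have {}ud : 1 - d < set_val u by lra.
move=> /(_ ud) us /(_ sd) ss.
rewrite -[_ - muntz_eval u x](subrKA (muntz_eval one x)).
rewrite (le_trans (ler_normD _ _))// distrC.
by rewrite (le_trans (lerD (ltW ss) (ltW us)))// -splitr.
Qed.

Section MuntzOctahedral.
Context {R : realType} {L : nat -> R} (L0 : forall k, 0 <= L k).
Context (Li : {homo L : m n / (m < n)%N >-> m < n}).
Context (Ls : (\sum_(1 <= k <oo) ((L k)^-1)%:E < +oo)%E).
Local Notation e_ := (muntz_monomial L0).

(** The choices are made in the order [n], [t], [m]: first [t^(L n)] is small on [[0, r]], then [t]
    is where it equals [1 - e], and then [t^(L m)] is at most [e] at that point. *)
Lemma muntz_spike (l : seq (dual (muntz L0))) (r e : R) :
  0 <= r < 1 -> 0 < e <= 1 / 4 ->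
  exists (p : muntz L0) (t : I01 R), [/\ r <= set_val t,
    forall f, f \in l -> `|f p| <= e,
    1 - 2 * e <= muntz_eval t p,
    forall s, 0 <= muntz_eval s p <= 1 &
    forall s, set_val s <= r -> muntz_eval s p <= e] /\
    0 < `|muntz_delta L0 t|.
Proof.
move=> r01 /andP[e0 e4].
have [N HN] := muntz_monomial_cauchy_seq L0 Li l _ e0.
have [B HB] := powR_small _ _ _ r01 e0.
have [N1 HN1] := nneseries_inv_unbounded _ L B Li (L0 0%N) Ls.
(* The successor ensures [0 < L n] even when [L 0 = 0]. *)
pose n := (maxn N N1).+1.
have Ln0 : 0 < L n by rewrite (le_lt_trans (L0 0%N))// Li.
have rn : r `^ L n <= e by apply/HB/HN1; rewrite leqW// leq_maxr.
pose t0 := (1 - e) `^ (L n)^-1.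
have t0n : t0 `^ L n = 1 - e by rewrite -powRrM mulVf ?gt_eqF// powRr1//; lra.
have t0ge0 : 0 <= t0 by exact: powR_ge0.
have t0lt1 : t0 < 1.
  rewrite ltNge; apply/negP => t1.
  have : 1 `^ L n <= t0 `^ L n by rewrite ge0_ler_powR// ?nnegrE// ltW.
  by rewrite powR1 t0n; lra.
(* Otherwise [1 - e = t0^(L n) < r^(L n) <= e], impossible for [e <= 1 / 4]. *)
have rt0 : r <= t0.
  rewrite leNgt; apply/negP => tr; have /andP[r0 _] := r01.
  have : t0 `^ L n < r `^ L n by rewrite gt0_ltr_powR ?nnegrE.
  by rewrite t0n; lra.
have t01 : t0 \in (`[0, 1]%classic : set R) by rewrite inE/= in_itv/= t0ge0 ltW.
pose t : I01 R := exist _ t0 t01.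
have [B' HB'] : exists B, forall k, B < k -> t0 `^ k <= e.
  by apply: powR_small => //; rewrite t0ge0.
have [N2 HN2] := nneseries_inv_unbounded _ L B' Li (L0 0%N) Ls.
pose m := maxn n N2.
have nm : (n <= m)%N by exact: leq_maxl.
have tm : t0 `^ L m <= e by apply/HB'/HN2; exact: leq_maxr.
exists (e_ n - e_ m), t; split; first split=> //.
- by move=> f fl; apply: HN => //; rewrite nm andbT leqW// leq_maxl.
- by rewrite muntz_monomialB -[set_val t]/t0 t0n; lra.
- move=> s; rewrite muntz_monomialB subr_ge0 muntz_monomial_antitone//=.
  by rewrite lerBlDr ler_wpDr ?powR_ge0 ?powR_le1_unit ?I01P.
- move=> s sr; rewrite muntz_monomialB lerBlDr ler_wpDr ?powR_ge0//.
  apply: le_trans rn; have /andP[s0 _] := I01P s; have /andP[r0 _] := r01.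
  by rewrite ge0_ler_powR ?nnegrE// ltW.
(* The evaluation at [t] is nonzero because it takes the value [1 - e] on [e_ n]. *)
have := dual_apply_le _ _ (muntz_delta L0 t) (e_ n).
rewrite [X in `|X| <= _]muntz_monomialE -[set_val t]/t0 t0n ger0_norm; last by lra.
move=> H; rewrite lt_neqAle normr_ge0 andbT eq_sym; apply/eqP => H0.
by move: H; rewrite H0 mul0r; lra.
Qed.

Lemma muntz_eval_near1_seq (T : eqType) (l : seq T) (x : T -> muntz L0) (e : R) :
  0 < e ->
  exists2 r, 0 <= r < 1 & forall f, f \in l -> forall s u : I01 R,
    r <= set_val s -> r <= set_val u ->
    `|muntz_eval s (x f) - muntz_eval u (x f)| <= e.
Proof.
move=> e0; elim: l => [|f l [r r01 Hr]]; first by exists 0; rewrite ?lexx ?ltr01.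
have [q q01 Hq] := muntz_eval_near1 (x f) _ e0.
exists (Num.max q r).
  by rewrite le_max gt_max; case/andP: r01 => -> ->; case/andP: q01 => -> ->.
move=> g; rewrite inE => /orP[/eqP->|gl] s u; rewrite !ge_max => /andP[qs rs] /andP[qu ru].
  exact: Hq.
exact: Hr.
Qed.

Lemma muntz_dual_octahedral_seq (l : seq (dual (muntz L0))) (e : R) : 0 < e ->
  exists2 y : dual (muntz L0), `|y| = 1 &
    forall f, f \in l -> (1 - e) * (`|f| + 1) <= `|f + y|.
Proof.
(* The loss at the test vector [z] is [7 * d], and its norm [1 + 2 * d] costs another [2 * d]
   relative to [|f| + 1]. *)
move=> e0; pose d := Num.min 1 e / 9.
have [d0 d4 de] : [/\ 0 < d, d <= 1 / 4 & 9 * d <= e].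
  rewrite /d; have : 0 < Num.min 1 e by rewrite lt_min ltr01.
  have : Num.min 1 e <= 1 by rewrite ge_min lexx.
  have : Num.min 1 e <= e by rewrite ge_min lexx orbT.
  by move=> ? ? ?; split; lra.
have /boolp.choice[x Hx] : forall f : dual (muntz L0), exists x : muntz L0,
    `|x| <= 1 /\ `|f| - d <= f x.
  by move=> f; have [x x1 fx] := dual_norm_approx _ _ f _ d0; exists x.
have [r r01 Hr] := muntz_eval_near1_seq _ l x _ d0.
have [p [t [[rt pf pt p01 ps] dt0]]] := muntz_spike l r d r01 ltac:(by rewrite d0).
pose y := `|muntz_delta L0 t|^-1 *: muntz_delta L0 t.
have y1 : `|y| = 1 by rewrite normrZ normfV normr_id mulVf// gt_eqF.
exists y => // f fl; have [x1 fx] := Hx f.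
have xs s : -1 <= muntz_eval s (x f) <= 1.
  by rewrite -ler_norml (le_trans (muntz_eval_le _ _ _)).
(* This is the amount missing from the value 1 at [t]. *)
pose c : R := 1 - muntz_eval t (x f).
pose z := x f + c *: p.
have c02 : 0 <= c <= 2 by rewrite /c; have := xs t; lra.
have zE s : muntz_eval s z = muntz_eval s (x f) + c * muntz_eval s p.
  by rewrite linearD linearZ.
have z1 : `|z| <= 1 + 2 * d.
  apply: muntz_norm_le => s; rewrite zE.
  have /andP[p0 p1] := p01 s; have /andP[c0 c2] := c02; have /andP[xs0 xs1] := xs s.
  have [sr|/ltW rs] := leP (set_val s) r.
    have pd := ps s sr.
    have : 0 <= c * muntz_eval s p by rewrite mulr_ge0.
    have : c * muntz_eval s p <= 2 * d by rewrite ler_pM.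
    by rewrite ler_norml => ? ?; apply/andP; split; lra.
  (* Beyond [r], [x f] is within [d] of its value at [t], so adding at most [c] gives at most
     [1 + d]; the lower bound survives as the added term is nonnegative. *)
  have := Hr f fl s t rs rt; rewrite ler_norml => /andP[h1 h2].
  have /andP[xt0 xt1] := xs t; rewrite ler_norml /c.
  by apply/andP; split; nra.
have zt : 1 - 4 * d <= muntz_eval t z.
  rewrite zE; have /andP[p0 p1] := p01 t; have /andP[c0 c2] := c02.
  have : (1 - muntz_eval t p) * c <= 2 * d * 2 by rewrite ler_pM//; lra.
  have -> : muntz_eval t (x f) = 1 - c by rewrite /c opprB addrC subrK.
  lra.
have fz : `|f| - 3 * d <= f z.
  have -> : f z = f (x f) + c * f p by rewrite linearD linearZ.
  have : `|c * f p| <= 2 * d.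
    by have /andP[c0 c2] := c02; rewrite normrM ger0_norm// ler_pM// pf.
  by rewrite ler_norml => /andP[? ?]; lra.
(* Dividing by a norm at most 1 does not decrease the value at [z], which is nonnegative as
   [d <= 1 / 4]. *)
have yz : 1 - 4 * d <= y z.
  rewrite (le_trans zt)// -[y z]/(`|muntz_delta L0 t|^-1 * muntz_eval t z).
  rewrite ler_peMl//; first lra.
  by rewrite invf_ge1//; exact: muntz_delta_norm.
have : `|f| + 1 - 7 * d <= `|f + y| * (1 + 2 * d).
  apply: (@le_trans _ _ ((f + y) z)).
    by rewrite -[(f + y) z]/(f z + y z); lra.
  rewrite (le_trans (ler_norm _))// (le_trans (dual_apply_le _ _ _ _))//.
  by rewrite ler_wpM2l.
(* The trivial upper bound controls the product [2 * d * |f + y|] in the preceding estimate. *)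
have : `|f + y| <= `|f| + 1 by rewrite -y1 ler_normD.
have := normr_ge0 f; have := normr_ge0 (f + y); nra.
Qed.

End MuntzOctahedral.

Theorem theorem2p5 (R : realType) (Lambda : nat -> R)
  (Lambda_ge0 : forall k, 0 <= Lambda k)
  (Lambda_incr : {homo Lambda : m n / (m < n)%N >-> m < n})
  (Lambda_sum : (\sum_(1 <= k <oo) ((Lambda k)^-1)%:E < +oo)%E) :
  octahedral (dual (muntz Lambda_ge0)).
Proof.
apply: octahedral_seq => l e e0.
exact: muntz_dual_octahedral_seq.
Qed.
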